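(* For $b>0$ let $f_b(\psi)=\exp(-be^\psi)$, $\psi\ge0$, and let $g_b$ be the bounding function on $[0,\infty)$ defined by $$g_b(\psi)=\exp\{-b(1+\psi)\}\quad\text{if } b\ge1,$$ and, if $b<1$, $$g_b(\psi)=\begin{cases}\exp(-b)&\text{for }\psi\le\log(1/b),\\ \exp\{-1-(\psi-\log(1/b))\}&\text{for }\psi\ge\log(1/b)\end{cases}$$ (the two pieces in the case $b<1$ need not agree at the single point $\psi=\log(1/b)$). Let $$A(b)=\frac{\int_0^\infty f_b(\psi)\,d\psi}{\int_0^\infty g_b(\psi)\,d\psi}$$ be the acceptance probability of the rejection sampler with unnormalized target density $f_b$ and bounding function $g_b$. Then $A(b)$ is uniformly lower bounded over $b>0$ by a positive constant. Moreover, $A(b)$ converges to $1$ as $b\to0$ and as $b\to\infty$.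
   Context: The rejection sampler proposes from the density proportional to $g_b$ and accepts a proposal $\psi$ with probability $f_b(\psi)/g_b(\psi)$. It is used to sample $\psi=\log(1+\eta)$ where $\eta=\lambda_j^{-2}$ has density proportional to $(1+\eta)^{-1}e^{-b\eta}$ on $\eta>0$, with $b=\beta_j^2/(2\tau^2)$, i.e. the conditional of the local scale under the horseshoe prior $\pi_{\rm loc}(\lambda)\propto1/(1+\lambda^2)$. *)

(* Defs.v *)
From mathcomp Require Import all_boot all_order all_algebra.
From mathcomp Require Import all_classical all_reals all_analysis.

Set Implicit Arguments.
Unset Strict Implicit.
Unset Printing Implicit Defensive.

Import Order.TTheory GRing.Theory Num.Theory.
Import numFieldNormedType.Exports.

Local Open Scope classical_set_scope.
Local Open Scope ring_scope.

Definition target {R : realType} (b psi : R) : R := expR (- (b * expR psi)).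

(* At the breakpoint [psi = ln b^-1] of the case [b < 1] the first piece is
   used; the value at this single point does not affect the integral. *)
Definition bounding {R : realType} (b psi : R) : R :=
  if 1 <= b then expR (- (b * (1 + psi)))
  else if psi <= ln b^-1 then expR (- b)
  else expR (- 1 - (psi - ln b^-1)).

(* For [b > 0] both integrands are positive and integrable on [0, +oo[, so the
   real-valued Lebesgue integrals are the actual ones and the denominator is
   positive; for [b <= 0] the value is meaningless. *)
Definition acceptance {R : realType} (b : R) : R :=
  (\int[@lebesgue_measure R]_(psi in `[0, +oo[) target b psi) /
  (\int[@lebesgue_measure R]_(psi in `[0, +oo[) bounding b psi).

(* Main.v *)
Require Import Defs.
From mathcomp Require Import all_boot all_order all_algebra.
From mathcomp Require Import all_classical all_reals all_analysis.
From mathcomp Require Import measurable_realfun ring lra.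

Set Implicit Arguments.
Unset Strict Implicit.
Unset Printing Implicit Defensive.

Import Order.TTheory GRing.Theory Num.Theory.
Import numFieldNormedType.Exports.

Local Open Scope classical_set_scope.
Local Open Scope ring_scope.

(** Write x = b e^psi, L = ln (1/b), F and G for the integrals of the target
    and of the bounding function.  Pointwise domination gives F <= G.  All
    other estimates come from comparing an integrand with the derivative of an
    explicit primitive:
    - -e^(-x) / (1 + x) gives F >= e^(-b) / (1 + b);
    - e^(-x) >= 1 - x on [0, L] gives F >= L - 1 when b < 1;
    - G <= e^(-b) / b when b >= 1;
    - -(ln (1 + y) + 2 y / (1 + y)) with y = 1 / x gives G <= L + 3 when b < 1.
    Hence A(b) >= 1 - 1 / (1 + b) for b >= 1, while for b < 1 both
    A(b) >= (L - 1) / (L + 3) (used for large L) and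
    A(b) >= (e^(-1) / 2) / (L + 3) (used for L < 3) hold. *)

(** * Comparing integrals over a half-line with explicit primitives *)

Lemma derive1_is_derive (R : realType) (F f : R -> R) (x : R) :
  is_derive x 1 F (f x) -> F^`()%classic x = f x.
Proof. by move=> dF; rewrite derive1E; apply: derive_val. Qed.

Lemma is_derive_continuous (R : realType) (F f : R -> R) :
  (forall x : R, is_derive x 1 F (f x)) -> continuous F.
Proof.
move=> dF x; apply: differentiable_continuous.
exact/derivable1_diffP/(@ex_derive _ _ _ _ _ _ _ (dF x)).
Qed.

(** The squeeze [0 <= f <= h] makes [h] nonnegative, so the fundamental theorem on the half-line
    evaluates its integral as the finite number [l - H a]; domination then gives both conclusions
    for [f]. *)
Lemma Rintegral_le_primitive (R : realType) (f h H : R -> R) (a l : R) :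
  measurable_fun `[a, +oo[ f ->
  (forall x, a <= x -> 0 <= f x <= h x) ->
  continuous h -> (forall x : R, is_derive x 1 H (h x)) ->
  H x @[x --> +oo] --> l ->
  (@lebesgue_measure R).-integrable `[a, +oo[ (EFin \o f) /\
  \int[@lebesgue_measure R]_(x in `[a, +oo[) f x <= l - H a.
Proof.
move=> mf fh ch dH Hl.
have h0 x : a <= x -> 0 <= h x.
  by move=> /fh /andP[f0 /(le_trans f0)].
have cH := is_derive_continuous dH.
have mh : measurable_fun `[a, +oo[ h.
  by apply: measurable_funTS; exact: continuous_measurable_fun.
have inth : (\int[@lebesgue_measure R]_(x in `[a, +oo[) (h x)%:E
    = l%:E - (H a)%:E)%E.
  apply: ge0_continuous_FTC2y => //.
  - exact: continuous_subspaceT.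
  - exact: cvg_at_right_filter (cH a).
  - by move=> x _; exact: derive1_is_derive.
have ih : (@lebesgue_measure R).-integrable `[a, +oo[ (EFin \o h).
  apply/integrableP; split; first exact/measurable_EFinP.
  under eq_integral => x xa.
    rewrite /= ger0_norm; last first.
      by apply: h0; move: xa; rewrite inE /= in_itv/= andbT.
    over.
  by rewrite inth -EFinB ltry.
have if_ : (@lebesgue_measure R).-integrable `[a, +oo[ (EFin \o f).
  apply: le_integrable ih => //; first exact/measurable_EFinP.
  move=> x /=; rewrite in_itv/= andbT => ax.
  by have /andP[f0 fhx] := fh _ ax; rewrite lee_fin !ger0_norm ?h0.
split=> //.
have -> : l - H a = \int[@lebesgue_measure R]_(x in `[a, +oo[) h x.
  by rewrite /Rintegral inth.
apply: le_Rintegral => // x /=; rewrite in_itv/= andbT => ax.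
by have /andP[] := fh _ ax.
Qed.

(** The comparison takes place on the segment only; since [f] is nonnegative, adding the tail beyond
    [T] can only increase its integral. Thus [h] may become negative after [T], and [T] can be
    chosen to make [H T] large. *)
Lemma primitive_le_Rintegral (R : realType) (f h H : R -> R) (a T : R) :
  (@lebesgue_measure R).-integrable `[a, +oo[ (EFin \o f) ->
  (forall x, a <= x -> 0 <= f x) ->
  (forall x, a <= x <= T -> h x <= f x) ->
  continuous h -> (forall x : R, is_derive x 1 H (h x)) ->
  a <= T ->
  H T - H a <= \int[@lebesgue_measure R]_(x in `[a, +oo[) f x.
Proof.
(* The fundamental theorem on a segment needs [a < T]; for [a = T] the left side is 0. *)
move=> if_ f0 hf ch dH; rewrite le_eqVlt => /predU1P[<-|aT].
  rewrite subrr; apply: Rintegral_ge0 => x /=.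
  by rewrite in_itv/= andbT; exact: f0.
have cH := is_derive_continuous dH.
have sub : `[a, T] `<=` `[a, +oo[.
  by move=> x /=; rewrite !in_itv/= => /andP[->].
have inth : (\int[@lebesgue_measure R]_(x in `[a, T]) (h x)%:E
    = (H T)%:E - (H a)%:E)%E.
  apply: continuous_FTC2 => //.
  - exact: continuous_subspaceT.
  - split => //.
    + exact: cvg_at_right_filter (cH a).
    + exact: cvg_at_left_filter (cH T).
  - by move=> x _; exact: derive1_is_derive.
have ifT : (@lebesgue_measure R).-integrable `[a, T] (EFin \o f).
  by apply: integrableS if_.
have ih : (@lebesgue_measure R).-integrable `[a, T] (EFin \o h).
  apply: continuous_compact_integrable; first exact: segment_compact.
  exact: continuous_subspaceT.
have -> : H T - H a = \int[@lebesgue_measure R]_(x in `[a, T]) h x.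
  by rewrite /Rintegral inth.
apply: (@le_trans _ _ (\int[@lebesgue_measure R]_(x in `[a, T]) f x)).
  by apply: le_Rintegral => // x /=; rewrite in_itv/=; exact: hf.
rewrite /Rintegral fine_le ?integrable_fin_num//.
apply: ge0_subset_integral => //; first by case/integrableP : if_.
by move=> x /=; rewrite in_itv/= andbT lee_fin; exact: f0.
Qed.

(** * Sign, domination and measurability of the two integrands *)

Lemma target_ge0 (R : realType) (b x : R) : 0 <= target b x.
Proof. exact: expR_ge0. Qed.

Lemma bounding_ge0 (R : realType) (b x : R) : 0 <= bounding b x.
Proof. by rewrite /bounding; case: ifP => _; [|case: ifP => _]; exact: expR_ge0. Qed.

Lemma expR_lnV (R : realType) (b : R) : 0 < b -> expR (ln b^-1) = b^-1.
Proof. by move=> b0; rewrite lnK// posrE invr_gt0. Qed.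

(** Each piece of the bounding function replaces an exponential in the exponent by a minorant:
    [expR x >= 1 + x] for [b >= 1], [expR x >= 1] on the flat piece, and on the last piece the
    tangent at the breakpoint, [b * expR x = expR (x - L) >= 1 + (x - L)]. *)
Lemma target_le_bounding (R : realType) (b x : R) :
  0 < b -> 0 <= x -> target b x <= bounding b x.
Proof.
move=> b0 x0; rewrite /target /bounding; case: ifP => _.
  by rewrite ler_expR lerN2 ler_pM2l// expR_ge1Dx.
case: ifP => _; first by rewrite ler_expR lerN2 ler_peMr ?(ltW b0)// -expR0 ler_expR.
have -> : b * expR x = expR (x - ln b^-1).
  by rewrite expRB expR_lnV// invrK mulrC.
by rewrite ler_expR -opprD lerN2 expR_ge1Dx.
Qed.

Lemma measurable_target (R : realType) (b : R) (D : set R) :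
  measurable_fun D (target b).
Proof.
apply: measurable_funTS; apply: measurableT_comp => //.
apply: measurableT_comp => //; exact: measurable_funM.
Qed.

Lemma measurable_bounding (R : realType) (b : R) (D : set R) :
  measurable_fun D (bounding b).
Proof.
apply: measurable_funTS; rewrite /bounding; case: (1 <= b).
  apply: measurableT_comp => //; apply: measurableT_comp => //.
  apply: measurable_funM => //; exact: measurable_funD.
apply: measurable_fun_ifT => //; first exact: measurable_fun_ler.
apply: measurableT_comp => //; apply: measurable_funB => //.
exact: measurable_funB.
Qed.

(** * Derivatives and a limit for the building blocks of the primitives *)

Lemma is_derive_scale_expR (R : realType) (c x : R) :
  is_derive x 1 (fun z => c * expR z) (c * expR x).
Proof. exact: (is_deriveZ c (is_derive_expR x)). Qed.

Lemma is_derive_scale_expRN (R : realType) (c x : R) :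
  is_derive x 1 (fun z => c * expR (- z)) (- (c * expR (- x))).
Proof.
have d := is_derive1_comp (is_derive_expR (- x)) (is_deriveNid x (1 : R)).
refine (is_derive_eq (is_deriveZ c d) _).
by rewrite /GRing.scale /=; ring.
Qed.

Lemma is_derive_inv1D (R : realType) (u : R -> R) (x du : R) :
  1 + u x != 0 -> is_derive x 1 u du ->
  is_derive x 1 (fun z => (1 + u z)^-1) (- (du * (1 + u x)^-1 * (1 + u x)^-1)).
Proof.
move=> u0 dU; have d1 : is_derive x 1 (fun z => 1 + u z) (0 + du).
  exact: is_deriveD (is_derive_cst (1 : R) x 1) dU.
refine (is_derive_eq (@is_deriveV _ (fun z => 1 + u z) _ _ _ u0 d1) _).
by rewrite /GRing.scale /= add0r -exprVn expr2; ring.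
Qed.

Lemma is_derive_ln1D (R : realType) (u : R -> R) (x du : R) :
  0 < 1 + u x -> is_derive x 1 u du ->
  is_derive x 1 (fun z => ln (1 + u z)) (du * (1 + u x)^-1).
Proof.
move=> u0 dU; have d1 : is_derive x 1 (fun z => 1 + u z) (0 + du).
  exact: is_deriveD (is_derive_cst (1 : R) x 1) dU.
refine (is_derive_eq (is_derive1_comp (g := fun z => 1 + u z) (is_derive1_ln u0) d1) _).
by rewrite add0r mulrC.
Qed.

Lemma is_derive_target (R : realType) (b x : R) :
  is_derive x 1 (target b) (- (b * expR x * target b x)).
Proof.
have d := is_deriveN (is_derive_scale_expR b x).
refine (is_derive_eq (is_derive1_comp (g := fun z => - (b * expR z))
  (is_derive_expR (- (b * expR x))) d) _).
by rewrite /target; ring.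
Qed.

Lemma cvg_scale_expRN (R : realType) (c : R) :
  c * expR (- x) @[x --> +oo] --> (0 : R).
Proof.
by rewrite -[X in _ --> X](mulr0 c); apply: cvgM; [exact: cvg_cst|exact: cvgr_expR].
Qed.

(** * Lower bounds for the integral of the target *)

(** With [u = b * expR x], the primitive [- expR (- u) / (1 + u)] has derivative
    [expR (- u) * (1 - (1 + u)^-2)], which is below the target. It tends to 0, so the bound on
    [[0, T]] passes to the limit in [T]. *)
Lemma target_integral_ge (R : realType) (b : R) :
  0 < b ->
  (@lebesgue_measure R).-integrable `[0, +oo[ (EFin \o target b) ->
  expR (- b) / (1 + b) <= \int[@lebesgue_measure R]_(x in `[0, +oo[) target b x.
Proof.
move=> b0 it.
pose u x := b * expR x; pose v x := (1 + u x)^-1.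
have u0 x : 0 < u x by rewrite /u mulr_gt0 ?expR_gt0.
have u1 x : 1 + u x != 0 by rewrite gt_eqF// addr_gt0.
have v0 x : 0 < v x by rewrite invr_gt0 addr_gt0.
have du (x : R) : is_derive x 1 u (u x) by exact: is_derive_scale_expR.
have dv (x : R) : is_derive x 1 v (- (u x * v x * v x)).
  exact: is_derive_inv1D.
have dt x := is_derive_target b x.
pose H x := - (target b x * v x).
pose h x := target b x * (u x * v x + u x * v x * v x).
have dH (x : R) : is_derive x 1 H (h x).
  refine (is_derive_eq (is_deriveN (is_deriveM (dt x) (dv x))) _).
  by rewrite /h /GRing.scale /= -/(u x); ring.
have cu := is_derive_continuous du.
have cv := is_derive_continuous dv.
have ct := is_derive_continuous dt.
have ch : continuous h.
  move=> x; apply: cvgM; first exact: ct.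
  apply: cvgD; first by apply: cvgM; [exact: cu|exact: cv].
  by apply: cvgM; [apply: cvgM; [exact: cu|exact: cv]|exact: cv].
have ht x : h x <= target b x.
  rewrite /h ler_piMr ?target_ge0//.
  have -> : u x * v x + u x * v x * v x = 1 - v x * v x.
    by rewrite /v; field.
  by rewrite gerBl mulr_ge0// ltW.
have -> : expR (- b) / (1 + b) = 0 - H 0.
  by rewrite /H /v /u /target expR0 mulr1 sub0r opprK.
have H_le T : 0 <= T ->
    H T - H 0 <= \int[@lebesgue_measure R]_(x in `[0, +oo[) target b x.
  by move=> T0; apply: primitive_le_Rintegral dH T0 => // x _; exact: target_ge0.
(* The target is at most 1 and [v x <= (u x)^-1 = b^-1 * expR (- x)], which squeezes [H] to 0. *)
have Hlim : H x @[x --> +oo] --> (0 : R).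
  apply: (@squeeze_cvgr _ _ _ _ (fun x => - (b^-1 * expR (- x))) (fun=> 0)).
  - near=> x; rewrite /H oppr_le0 mulr_ge0 ?target_ge0 ?(ltW (v0 x))// andbT lerN2.
    apply: (@le_trans _ _ (v x)).
      rewrite ler_piMl ?(ltW (v0 x))// /target -expR0 ler_expR oppr_le0.
      exact/ltW/u0.
    rewrite expRN -invfM /v lef_pV2 ?posrE ?addr_gt0//; last exact: u0.
    by rewrite lerDr.
  - by rewrite -oppr0; apply: cvgN; exact: cvg_scale_expRN.
  - exact: cvg_cst.
have Blim : H x - H 0 @[x --> +oo] --> 0 - H 0.
  by apply: cvgB; [exact: Hlim|exact: cvg_cst].
by apply: (cvgr_to_le Blim); near=> T; exact: H_le.
Unshelve. all: by end_near. Qed.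

Lemma target_integral_ge_ln (R : realType) (b : R) :
  0 < b -> b < 1 ->
  (@lebesgue_measure R).-integrable `[0, +oo[ (EFin \o target b) ->
  ln b^-1 - 1 <= \int[@lebesgue_measure R]_(x in `[0, +oo[) target b x.
Proof.
move=> b0 b1 it.
pose h x := 1 - b * expR x; pose H x := x - b * expR x.
have dH (x : R) : is_derive x 1 H (h x).
  exact: is_deriveB (is_derive_id x (1 : R)) (is_derive_scale_expR b x).
have ch : continuous h.
  move=> x; apply: cvgB; first exact: cvg_cst.
  exact: (is_derive_continuous (is_derive_scale_expR b)).
have L0 : 0 <= ln b^-1 by rewrite ln_ge0// invf_ge1// ltW.
have := @primitive_le_Rintegral _ _ h H 0 (ln b^-1) it _ _ ch dH L0.
move=> /(_ (fun x _ => target_ge0 b x)).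
have ht x : 0 <= x <= ln b^-1 -> h x <= target b x.
  by move=> _; rewrite /h /target expR_ge1Dx.
move=> /(_ ht); apply: le_trans.
(* At the endpoint [b * expR L = 1], so the increment of [H] is [L - 1 + b], and [b] is positive. *)
rewrite /H expR_lnV// expR0 divff ?gt_eqF//; lra.
Qed.

(** * Upper bounds for the integral of the bounding function *)

Lemma bounding_integral_ge1 (R : realType) (b : R) :
  1 <= b ->
  (@lebesgue_measure R).-integrable `[0, +oo[ (EFin \o bounding b) /\
  \int[@lebesgue_measure R]_(x in `[0, +oo[) bounding b x <= expR (- b) / b.
Proof.
move=> b1; have b0 : 0 < b by exact: lt_le_trans b1.
pose h x := expR (- (b * (1 + x))); pose H x := - b^-1 * h x.
have dh (x : R) : is_derive x 1 h (- b * h x).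
  have d := is_deriveN (is_deriveZ b
    (is_deriveD (is_derive_cst (1 : R) x 1) (is_derive_id x (1 : R)))).
  refine (is_derive_eq (is_derive1_comp (g := fun z => - (b * (1 + z)))
    (is_derive_expR (- (b * (1 + x)))) d) _).
  by rewrite /h /GRing.scale /=; ring.
have dH (x : R) : is_derive x 1 H (h x).
  refine (is_derive_eq (is_deriveZ (- b^-1) (dh x)) _).
  by rewrite /GRing.scale /= mulrA mulrNN mulVf ?gt_eqF// mul1r.
have Hlim : H x @[x --> +oo] --> (0 : R).
  rewrite -(mulr0 (- b^-1)); apply: cvgM; first exact: cvg_cst.
  apply: (@squeeze_cvgr _ _ _ _ (fun=> 0) (fun x => 1 * expR (- x))).
  - near=> x; rewrite expR_ge0 mul1r ler_expR lerN2/=.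
    have x0 : 0 <= x by [].
    (* Here [1 <= b] enters: [b * (1 + x) >= b * x >= x]. *)
    by rewrite mulrDr mulr1 (@le_trans _ _ (b * x)) ?ler_peMl// lerDr ltW.
  - exact: cvg_cst.
  - exact: cvg_scale_expRN.
have -> : expR (- b) / b = 0 - H 0.
  by rewrite /H /h addr0 mulr1 mulNr sub0r opprK mulrC.
apply: Rintegral_le_primitive (is_derive_continuous dh) dH Hlim.
- exact: measurable_bounding.
- by move=> x _; rewrite bounding_ge0 /bounding b1/=.
Unshelve. all: by end_near. Qed.

(** A single smooth majorant of both pieces avoids splitting the integral at the breakpoint. In the
    variable [y = expR (L - x)] the breakpoint is [y = 1], and the pieces are at most 1 for [y >= 1]
    and equal to [expR (- 1) * y] for [y < 1]. *)
Lemma bounding_integral_lt1 (R : realType) (b : R) :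
  0 < b -> b < 1 ->
  (@lebesgue_measure R).-integrable `[0, +oo[ (EFin \o bounding b) /\
  \int[@lebesgue_measure R]_(x in `[0, +oo[) bounding b x <= ln b^-1 + 3.
Proof.
move=> b0 b1.
pose y x := b^-1 * expR (- x); pose v x := (1 + y x)^-1.
have y0 x : 0 < y x by rewrite mulr_gt0 ?invr_gt0 ?expR_gt0.
have y1 x : 0 < 1 + y x by rewrite addr_gt0.
have y1n x : 1 + y x != 0 by rewrite gt_eqF.
have dy (x : R) : is_derive x 1 y (- y x) by exact: is_derive_scale_expRN.
have dv (x : R) : is_derive x 1 v (- (- y x * v x * v x)) by exact: is_derive_inv1D.
have dl (x : R) : is_derive x 1 (fun z => ln (1 + y z)) (- y x * v x).
  exact: is_derive_ln1D.
pose H x := - (ln (1 + y x) + 2 * (y x * v x)).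
(* h = y (3 + y) / (1 + y)^2 is at least 1 for y >= 1 and at least y for y <= 1. *)
pose h x := 3 * (y x * v x) - 2 * (y x * v x) * (y x * v x).
have dH (x : R) : is_derive x 1 H (h x).
  refine (is_derive_eq (is_deriveN (is_deriveD (dl x)
    (is_deriveZ 2 (is_deriveM (dy x) (dv x))))) _).
  by rewrite /h /GRing.scale /=; ring.
have cy := is_derive_continuous dy.
have cv := is_derive_continuous dv.
have cyv : continuous (fun x => y x * v x).
  by move=> x; apply: cvgM; [exact: cy|exact: cv].
have ch : continuous h.
  move=> x; apply: cvgB; first by apply: cvgM; [exact: cvg_cst|exact: cyv].
  by apply: cvgM; [apply: cvgM; [exact: cvg_cst|]|]; exact: cyv.
have gh x : 0 <= x -> 0 <= bounding b x <= h x.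
  move=> x0; rewrite bounding_ge0/=.
  have hE : h x = y x * (3 + y x) / (1 + y x) ^+ 2.
    by rewrite /h /v; field.
  rewrite hE ler_pdivlMr ?exprn_gt0//.
  have yE : y x = expR (ln b^-1 - x) by rewrite expRD expR_lnV.
  rewrite /bounding (leNgt 1 b) b1/=; case: ifP => [xL|/negbT].
    have yge1 : 1 <= y x by rewrite yE -expR0 ler_expR subr_ge0.
    have eb : expR (- b) <= 1 by rewrite -expR0 ler_expR oppr_le0 ltW.
    apply: (@le_trans _ _ (1 * (1 + y x) ^+ 2)).
      by apply: ler_wpM2r => //; rewrite exprn_ge0// ltW.
    by move: yge1; set z := y x; nra.
  rewrite -ltNge => xL.
  have ylt1 : y x < 1 by rewrite yE -expR0 ltr_expR subr_lt0.
  have -> : expR (- 1 - (x - ln b^-1)) = expR (- 1) * y x.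
    by rewrite yE -expRD opprB.
  have e1 : expR (- 1) <= 1 :> R by rewrite -expR0 ler_expR oppr_le0.
  rewrite mulrAC mulrC ler_pM2l//.
  (* With the common factor [y x] cancelled, the bound follows from
     [3 + z - (1 + z)^2 = (1 - z) (2 + z) >= 0] for [0 < z < 1]. *)
  apply: (@le_trans _ _ (1 * (1 + y x) ^+ 2)).
    by apply: ler_wpM2r => //; rewrite exprn_ge0// ltW.
  by move: ylt1 (y0 x); set z := y x; nra.
have ylim : y x @[x --> +oo] --> (0 : R) by exact: cvg_scale_expRN.
have y1lim : 1 + y x @[x --> +oo] --> (1 : R).
  by rewrite -[X in _ --> X]addr0; apply: cvgD => //; exact: cvg_cst.
have Hlim : H x @[x --> +oo] --> (0 : R).
  have -> : 0 = - (ln 1 + 2 * (0 * 1^-1)) :> R.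
    by rewrite ln1 mul0r mulr0 addr0 oppr0.
  apply: cvgN; apply: cvgD.
    by apply: continuous_cvg => //; apply: continuous_ln.
  apply: cvgM; first exact: cvg_cst.
  by apply: cvgM => //; apply: cvgV => //; exact: oner_neq0.
have [ig le_g] :=
  Rintegral_le_primitive (@measurable_bounding _ b _) gh ch dH Hlim.
split=> //; apply: le_trans le_g _.
have yE : y 0 = b^-1 by rewrite /y oppr0 expR0 mulr1.
rewrite /H /v sub0r opprK yE.
(* Factoring splits the logarithm as [L + ln (1 + b)]. The constant 3 is then 1, from
   [ln (1 + b) <= b < 1], plus 2, from [2 / (1 + b) <= 2]. *)
have -> : 1 + b^-1 = b^-1 * (1 + b) by rewrite mulrDr mulr1 mulVf ?gt_eqF// addrC.
rewrite lnM ?posrE ?invr_gt0 ?addr_gt0// -addrA lerD2l.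
have l1 : ln (1 + b) <= 1 by rewrite (le_trans (le_ln1Dx _)) ?ltW// (lt_trans _ b0).
have -> : b^-1 / (b^-1 * (1 + b)) = (1 + b)^-1.
  by rewrite invfM invrK mulrA mulVf ?gt_eqF// mul1r.
have : (1 + b)^-1 <= 1 by rewrite invf_le1 ?addr_gt0// lerDl ltW.
by move: l1; lra.
Qed.

(** * Integrability, positivity and order of the two integrals *)

Lemma bounding_integrable (R : realType) (b : R) : 0 < b ->
  (@lebesgue_measure R).-integrable `[0, +oo[ (EFin \o bounding b).
Proof.
move=> b0; have [b1|b1] := ltP b 1.
  by have [] := bounding_integral_lt1 b0 b1.
by have [] := bounding_integral_ge1 b1.
Qed.

Lemma target_integrable (R : realType) (b : R) : 0 < b ->
  (@lebesgue_measure R).-integrable `[0, +oo[ (EFin \o target b).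
Proof.
move=> b0; apply: le_integrable (bounding_integrable b0) => //.
  by apply/measurable_EFinP; exact: measurable_target.
move=> x /=; rewrite in_itv/= andbT => x0.
by rewrite lee_fin !ger0_norm ?target_ge0 ?bounding_ge0// target_le_bounding.
Qed.

Lemma target_integral_gt0 (R : realType) (b : R) : 0 < b ->
  0 < \int[@lebesgue_measure R]_(x in `[0, +oo[) target b x.
Proof.
move=> b0; apply: lt_le_trans (target_integral_ge b0 (target_integrable b0)).
by rewrite divr_gt0 ?expR_gt0 ?addr_gt0.
Qed.

Lemma target_integral_le_bounding (R : realType) (b : R) : 0 < b ->
  \int[@lebesgue_measure R]_(x in `[0, +oo[) target b x <=
  \int[@lebesgue_measure R]_(x in `[0, +oo[) bounding b x.
Proof.
move=> b0; apply: le_Rintegral => //.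
- exact: target_integrable.
- exact: bounding_integrable.
- by move=> x /=; rewrite in_itv/= andbT; exact: target_le_bounding.
Qed.

Lemma bounding_integral_gt0 (R : realType) (b : R) : 0 < b ->
  0 < \int[@lebesgue_measure R]_(x in `[0, +oo[) bounding b x.
Proof.
move=> b0; exact: lt_le_trans (target_integral_gt0 b0)
  (target_integral_le_bounding b0).
Qed.

(** * Bounds on the acceptance probability, and its limits *)

Lemma acceptance_le1 (R : realType) (b : R) : 0 < b -> acceptance b <= 1.
Proof.
move=> b0; rewrite /acceptance ler_pdivrMr ?bounding_integral_gt0// mul1r.
exact: target_integral_le_bounding.
Qed.

Lemma acceptance_ge (R : realType) (b m M : R) : 0 < b -> 0 <= m ->
  m <= \int[@lebesgue_measure R]_(x in `[0, +oo[) target b x ->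
  \int[@lebesgue_measure R]_(x in `[0, +oo[) bounding b x <= M ->
  m / M <= acceptance b.
Proof.
move=> b0 m0 mF GM; have G0 := bounding_integral_gt0 b0.
have M0 : 0 < M by exact: lt_le_trans GM.
by apply: ler_pM => //; rewrite ?invr_ge0 ?(ltW M0)// lef_pV2.
Qed.

(** The factors [expR (- b)] in the bounds for F and G cancel, leaving [b / (1 + b)]. *)
Lemma acceptance_ge_ge1 (R : realType) (b : R) : 1 <= b ->
  1 - (1 + b)^-1 <= acceptance b.
Proof.
move=> b1; have b0 : 0 < b by exact: lt_le_trans b1.
have e0 := expR_gt0 (- b).
have m0 : 0 <= expR (- b) / (1 + b) by rewrite divr_ge0 ?ltW ?addr_gt0.
have [_ GM] := bounding_integral_ge1 b1.
have := acceptance_ge b0 m0 (target_integral_ge b0 (target_integrable b0)) GM.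
apply: le_trans; rewrite le_eqVlt; apply/orP; left; apply/eqP.
by field; rewrite !gt_eqF ?addr_gt0.
Qed.

(** The condition [1 <= ln b^-1] keeps the numerator nonnegative, as the comparison of quotients
    requires. *)
Lemma acceptance_ge_ln (R : realType) (b : R) : 0 < b -> b < 1 ->
  1 <= ln b^-1 -> (ln b^-1 - 1) / (ln b^-1 + 3) <= acceptance b.
Proof.
move=> b0 b1 L1; have [_ GM] := bounding_integral_lt1 b0 b1.
apply: acceptance_ge GM => //; first by rewrite subr_ge0.
by apply: target_integral_ge_ln => //; exact: target_integrable.
Qed.

(** The constant comes from the range [0 < L < 3], where [F >= expR (- 1) / 2] and [G <= 6]. The
    other ranges give more: at least 1/2 for [b >= 1], and at least 1/3 for [L >= 3]. *)
Lemma acceptance_lower_bound (R : realType) (b : R) : 0 < b ->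
  expR (- 1) / 12 <= acceptance b.
Proof.
move=> b0; have e1 : expR (- 1) <= 1 :> R.
  by rewrite -expR0 ler_expR oppr_le0.
have [b1|b1] := ltP b 1; last first.
  apply: le_trans (acceptance_ge_ge1 b1).
  have : (1 + b)^-1 <= 2^-1 by rewrite lef_pV2 ?posrE ?addr_gt0//; lra.
  by lra.
have L0 : 0 <= ln b^-1 by rewrite ln_ge0// invf_ge1// ltW.
have [L3|L3] := leP 3 (ln b^-1).
  apply: le_trans (acceptance_ge_ln b0 b1 _); last by lra.
  by rewrite ler_pdivlMr; [nra|lra].
have [_ GM] := bounding_integral_lt1 b0 b1.
have m0 : 0 <= expR (- 1) / 2 :> R by rewrite divr_ge0 ?expR_ge0.
have -> : expR (- 1) / 12 = expR (- 1) / 2 / 6 :> R by field.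
apply: acceptance_ge m0 _ _ => //.
  apply: le_trans (target_integral_ge b0 (target_integrable b0)).
  apply: ler_pM; rewrite ?expR_ge0 ?invr_ge0 ?ler_expR ?lerN2 ?(ltW b1)//.
  by rewrite lef_pV2 ?posrE ?addr_gt0//; lra.
by apply: le_trans GM _; lra.
Qed.

Theorem theoremG1 (R : realType) :
  (exists2 c : R, 0 < c & forall b : R, 0 < b -> c <= acceptance b) /\
  (acceptance b @[b --> (0 : R)^'+] --> (1 : R)) /\
  (acceptance b @[b --> +oo%R] --> (1 : R)).
Proof.
split; last split.
- exists (expR (- 1) / 12); first by rewrite divr_gt0 ?expR_gt0.
  exact: acceptance_lower_bound.
- have Ly : ln b^-1 + 3 @[b --> (0 : R)^'+] --> +oo.
    apply/cvgryPge => A; have /cvgrNyPle /(_ (3 - A)) := @lnNy R.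
    apply: filterS2 (nbhs_right_gt (0 : R)) => b b0 lb.
    by rewrite lnV ?posrE//; lra.
  (* This is [1 <= L], the condition under which the logarithmic bound on the acceptance probability
     holds. *)
  have Lpos : \forall b \near (0 : R)^'+, 4 <= ln b^-1 + 3.
    by move/cvgryPge : Ly; exact.
  (* The lower function is [(L - 1) / (L + 3)], rewritten so that only the reciprocal of a diverging
     quantity remains. *)
  apply: (@squeeze_cvgr _ _ _ _ (fun b => 1 - 4 * (ln b^-1 + 3)^-1) (fun=> 1)).
  + near=> b.
    have b0 : 0 < b by near: b; exact: nbhs_right_gt.
    have b1 : b < 1 by near: b; exact: nbhs_right_lt.
    have L1 : 4 <= ln b^-1 + 3 by near: b.
    rewrite acceptance_le1// andbT.
    apply: le_trans (acceptance_ge_ln b0 b1 _); last by lra.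
    rewrite ler_pdivlMr; last by lra.
    by rewrite mulrBl mul1r -mulrA mulVf ?gt_eqF//; lra.
  + rewrite -[X in _ --> X]subr0 -[X in _ --> _ - X](mulr0 4); apply: cvgB; first exact: cvg_cst.
    apply: cvgM; first exact: cvg_cst.
    apply/gtr0_cvgV0 => //; near=> b.
    by apply: (@lt_le_trans _ _ 4) => //; near: b.
  + exact: cvg_cst.
- apply: (@squeeze_cvgr _ _ _ _ (fun b => 1 - (1 + b)^-1) (fun=> 1)).
  + near=> b.
    have b1 : 1 <= b by [].
    by rewrite acceptance_ge_ge1// acceptance_le1// (lt_le_trans _ b1).
  + rewrite -[X in _ --> X]subr0; apply: cvgB; first exact: cvg_cst.
    apply/gtr0_cvgV0; first by near=> b; rewrite addr_gt0.
    apply/cvgryPge => A; near=> b.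
    have bA : A <= b by [].
    by rewrite (le_trans bA)// lerDr.
  + exact: cvg_cst.
Unshelve. all: by end_near. Qed.
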